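(* Let $G$ be a bipartite distance-regular graph with valency $k\ge 2$. Then $G$ is $t$-extendable, where $t=\left\lfloor \frac{k+1}{2} \right\rfloor$.
   Context: All graphs are finite, simple and undirected. A connected graph $G$ of diameter $D$ is distance-regular if there are integers $b_0,\dots,b_{D-1},c_1,\dots,c_D$ such that for all vertices $x,y$ at distance $i$, the vertex $y$ has exactly $c_i$ neighbors at distance $i-1$ from $x$ (for $1\le i\le D$) and exactly $b_i$ neighbors at distance $i+1$ from $x$ (for $0\le i\le D-1$). Such a graph is regular of valency $k=b_0$. A matching is a set of edges no two of which share a vertex; it is perfect if every vertex is incident with one of its edges. A connected graph of even order $v$ is called $t$-extendable if it contains a perfect matching, $t<v/2$, and every matching of $t$ edges is contained in some perfect matching. *)

(* Defs.v *)
From mathcomp Require Import all_boot.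

Set Implicit Arguments.
Unset Strict Implicit.
Unset Printing Implicit Defensive.

Record sgraph := SGraph {
  vertex :> finType;
  adj : rel vertex;
  adj_sym : symmetric adj;
  adj_irrefl : irreflexive adj
}.

Section GraphDefs.
Variable G : sgraph.
Implicit Types (x y z : G) (M : {set {set G}}).

(* The null graph is not connected. *)
Definition connected_graph : Prop :=
  0 < #|G| /\ forall x y, connect (@adj G) x y.

Definition has_walk (n : nat) x y : bool :=
  [exists p : n.-tuple G, path (@adj G) x p && (last x p == y)].

(* A shortest walk has length less than #|G|, so the search range is large
   enough; vertices in different components get the junk value #|G|. *)
Definition dist x y : nat := find (fun n => has_walk n x y) (iota 0 #|G|).

Definition diameter : nat := \max_(x : G) \max_(y : G) dist x y.

Definition neighbours x : {set G} := [set y | adj x y].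

(* The values [b i] for i >= D and [c i] for i = 0 or i > D are irrelevant. *)
Definition distance_regular : Prop :=
  connected_graph /\
  exists b c : nat -> nat,
    (forall i x y, 1 <= i <= diameter -> dist x y = i ->
       #|[set z in neighbours y | dist x z == i - 1]| = c i) /\
    (forall i x y, i < diameter -> dist x y = i ->
       #|[set z in neighbours y | dist x z == i + 1]| = b i).

Definition has_valency (k : nat) : Prop := forall x, #|neighbours x| = k.

Definition bipartite : Prop :=
  exists A : {set G}, forall x y, adj x y -> (x \in A) != (y \in A).

Definition edges : {set {set G}} :=
  [set [set p.1; p.2] | p : G * G & adj p.1 p.2].

Definition matching M : Prop := M \subset edges /\ trivIset M.

Definition perfect_matching M : Prop :=
  matching M /\ forall x, exists2 E, E \in M & x \in E.

Definition extendable (t : nat) : Prop :=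
  [/\ connected_graph,
      ~~ odd #|G|,
      exists M, perfect_matching M,
      t < #|G|./2
    & forall M, matching M -> #|M| = t ->
        exists2 N, perfect_matching N & M \subset N].

End GraphDefs.

Arguments connected_graph G : clear implicits.
Arguments diameter G : clear implicits.
Arguments distance_regular G : clear implicits.
Arguments has_valency G k : clear implicits.
Arguments bipartite G : clear implicits.
Arguments edges G : clear implicits.
Arguments extendable G t : clear implicits.

(* Main.v *)
Require Import Defs.
From mathcomp Require Import all_boot zify.

(** Let [A] and [~: A] be the two colour classes, of common size [n], and let
[t] be the required extendability.  Removing the endpoints of a matching of
[t] edges deletes [t] vertices from each class, so by Hall's marriage theorem
([hall_marriage], [matching_extends]) it is enough to prove the expansion
property ([expansion]): a nonempty [S] inside [A] with [#|S| + t <= n] has at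
least [#|S| + t] neighbours.

Suppose that the neighbourhood [N] of [S] has only [#|S| + r] elements with
[r < t], so that [2 * r < k].  No edge joins [S] to the nonempty set
[T = ~: A :\: N], and exactly [k * r] edges join [N] to [A :\: S].  A shortest
path of length [2j + 1] from [S] to [T] visits the two classes alternately, so
it can leave [S :|: N] only at one of its [j] steps from [~: A] to [A], through
one of these [k * r] edges.  In a distance-regular graph shortest paths of a
given length are evenly spread over the edges; counting them gives, with [k_i]
for the number of vertices at distance [i] from a given vertex, at most
[r * j * k_(2j+1)] pairs at distance [2j + 1] in [S * T]
([pairs_at_odd_bound]).  The proof replaces paths by an induction on the
distance ([pairs_at_step]), which uses that an edge [wz] has exactly
[k_i * b_i / k] vertices at distance [i] from [w] and [i + 1] from [z].

There are also at most [k_(2j+1) * #|S|] and at most [k_(2j+1) * #|T|] such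
pairs.  All distances between [S] and [T] are odd, so the best of these
bounds, summed over [j], give at least [#|S| * #|T|].  This contradicts [2 * r < k]: the sum
of the [k_(2j+1)] is [n = #|S| + #|T| + r], and all of them except possibly
the last one are at least [k] ([sphere_card_le]), so pairs at small distance,
where [r * j] is the best bound, are too numerous to be compensated
([short_flow_bound]). *)

Set Implicit Arguments.
Unset Strict Implicit.
Unset Printing Implicit Defensive.

(** * Hall's marriage theorem *)

Section Hall.
Variables T U : finType.
Implicit Types (e : T -> U -> bool) (A S : {set T}).

Definition image_of e S : {set U} := [set u | [exists x in S, e x u]].

Lemma image_ofP e S u : reflect (exists2 x, x \in S & e x u) (u \in image_of e S).
Proof. by rewrite inE; apply: exists_inP. Qed.

Lemma image_ofU e S1 S2 : image_of e (S1 :|: S2) = image_of e S1 :|: image_of e S2.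
Proof.
apply/setP=> u; apply/image_ofP/setUP => [[x /setUP[xS|xS] exu]|].
- by left; apply/image_ofP; exists x.
- by right; apply/image_ofP; exists x.
by case=> /image_ofP[x xS exu]; exists x; rewrite // inE xS ?orbT.
Qed.

(** Induction on [#|A|].  Either some proper nonempty [S] has exactly [#|S|]
neighbours, and Hall's condition passes to [S] and to the rest of [A] with the
neighbours of [S] removed; or every such [S] has a neighbour to spare, and any
edge may be chosen first.  The option type allows [U] to be empty. *)
Lemma hall_marriage e A :
  (forall S, S \subset A -> #|S| <= #|image_of e S|) ->
  exists f : T -> option U,
    {in A, forall x, exists2 u, f x = Some u & e x u} /\ {in A &, injective f}.
Proof.
have [n] := ubnP #|A|; elim: n e A => // n IHn e A ltAn hallA.
have [->|[a aA]] := set_0Vmem A.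
  by exists (fun=> None); split=> x; rewrite inE.
pose tight S := [&& S \proper A, S != set0 & #|image_of e S| <= #|S|].
have [/existsP[S /and3P[ltSA S0 tS]]|/existsPn noTight] := boolP [exists S, tight S].
  have [sSA _] := properP ltSA.
  have cardS : #|S| < n by rewrite (leq_trans (proper_card ltSA)).
  have [f [fS fI]] := IHn e S cardS (fun S' sS' => hallA S' (subset_trans sS' sSA)).
  pose e' x u := e x u && (u \notin image_of e S).
  have card_D : #|A :\: S| < n.
    move: ltAn S0; rewrite -card_gt0 -(cardsID S A) (setIidPr sSA); lia.
  (* Hall's condition for [R :|: S], where [S] uses up its whole image. *)
  have hallD (R : {set T}) : R \subset A :\: S -> #|R| <= #|image_of e' R|.
    rewrite subsetD => /andP[sRA dRS].
    have := hallA (R :|: S); rewrite subUset sRA sSA => /(_ isT).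
    have -> : image_of e (R :|: S) = image_of e' R :|: image_of e S.
      rewrite image_ofU; apply/setP=> u; rewrite !in_setU.
      have [uS|nuS] := boolP (u \in image_of e S); first by rewrite !orbT.
      rewrite !orbF; apply/image_ofP/image_ofP => -[x xR].
        by exists x; rewrite // /e' nuS andbT.
      by move=> /andP[exu _]; exists x.
    have [le_U _] := leq_card_setU (image_of e' R) (image_of e S).
    have [_] := leq_card_setU R S; rewrite dRS => /eqP->.
    lia.
  have [g [gD gI]] := IHn e' (A :\: S) card_D hallD.
  have neq x y : x \in S -> y \in A -> y \notin S -> f x <> g y.
    move=> xS yA yS; have [u -> exu] := fS x xS.
    have [|v -> /andP[_ /negP vS] [uv]] := gD y; first by rewrite inE yS.
    by case: vS; rewrite -uv; apply/image_ofP; exists x.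
  exists (fun x => if x \in S then f x else g x); split=> [x xA|x y xA yA].
    case: ifPn => xS; first exact: fS.
    have [|u fu /andP[exu _]] := gD x; first by rewrite inE xS.
    by exists u.
  case: ifPn => xS; case: ifPn => yS.
  - exact: fI.
  - by move/neq; case.
  - by move/esym/neq; case.
  - by apply: gI; rewrite inE ?xS ?yS.
have : 0 < #|image_of e [set a]|.
  by apply: leq_trans (hallA [set a] _); rewrite ?cards1 ?sub1set.
case/card_gt0P => u /image_ofP[_ /set1P-> eau].
pose e' x v := e x v && (v != u).
have cardA : #|A :\ a| < n by move: ltAn; rewrite (cardsD1 a A) aA.
have hallA' (R : {set T}) : R \subset A :\ a -> #|R| <= #|image_of e' R|.
  rewrite subsetD1 => /andP[sRA aR].
  have [->|R0] := eqVneq R set0; first by rewrite cards0.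
  have ltRA : R \proper A by apply/properP; split=> //; exists a.
  have := noTight R; rewrite /tight ltRA R0 /= -ltnNge.
  rewrite (cardsD1 u (image_of e R)) => ltR.
  have le1 : (u \in image_of e R) <= 1 by case: (_ \in _).
  have -> : image_of e' R = image_of e R :\ u; last by lia.
  apply/setP=> v; rewrite in_setD1 andbC.
  apply/image_ofP/andP => [[x xR /andP[exv vu]]|[/image_ofP[x xR exv] vu]].
    by split=> //; apply/image_ofP; exists x.
  by exists x; rewrite // /e' exv.
have [g [gA gI]] := IHn e' (A :\ a) cardA hallA'.
exists (fun x => if x == a then Some u else g x).
have neq y : y \in A -> y != a -> g y <> Some u.
  move=> yA ya; have [|v -> /andP[_ vu] [vu']] := gA y; first by rewrite !inE ya.
  by rewrite vu' eqxx in vu.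
split=> [x xA|x y xA yA].
  case: eqVneq => [->|xa]; first by exists u.
  by have [|v gv /andP[exv _]] := gA x; [rewrite !inE xa | exists v].
case: eqVneq => [->|xa]; case: eqVneq => [-> //|ya].
- by move/esym/neq; case.
- by move/neq; case.
- by apply: gI; rewrite !inE ?xa ?ya.
Qed.

End Hall.

(** * Distances in a connected graph *)
Section Distance.
Variable G : sgraph.
Hypothesis connG : connected_graph G.
Implicit Types x y z : G.

Lemma has_walkP n x y :
  reflect (exists2 p : seq G, size p = n & path (@adj G) x p /\ last x p = y)
          (has_walk n x y).
Proof.
apply: (iffP existsP) => [[p /andP[pp /eqP lp]] | [p /eqP sp [pp lp]]].
  by exists p; rewrite ?size_tuple.
by exists (Tuple sp); rewrite /= pp lp eqxx.
Qed.

Lemma has_walk_cat m n x y z :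
  has_walk m x y -> has_walk n y z -> has_walk (m + n) x z.
Proof.
move=> /has_walkP[p sp [pp lp]] /has_walkP[q sq [pq lq]].
apply/has_walkP; exists (p ++ q); first by rewrite size_cat sp sq.
by rewrite cat_path last_cat pp lp.
Qed.

Lemma has_walk1 x y : has_walk 1 x y = adj x y.
Proof.
apply/has_walkP/idP => [[[|z []] //= _ [/andP[xz _] <-]] // | xy].
by exists [:: y] => //=; rewrite xy.
Qed.

Lemma has_walkSr n x y :
  has_walk n.+1 x y -> exists2 z, has_walk n x z & adj z y.
Proof.
move=> /has_walkP[p]; case/lastP: p => [//|p z]; rewrite size_rcons => -[sp].
rewrite rcons_path last_rcons => -[/andP[pp lz] <-].
by exists (last x p) => //; apply/has_walkP; exists p.
Qed.

Lemma has_walk_sym n x y : has_walk n x y -> has_walk n y x.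
Proof.
elim: n x y => [|n IHn] x y.
  move=> /has_walkP[[]// _ [_ /= ->]].
  by apply/has_walkP; exists [::].
move=> /has_walkSr[z /IHn zx zy]; rewrite -add1n.
by apply: has_walk_cat zx; rewrite has_walk1 adj_sym.
Qed.

(** The search in [dist] returns at most [#|G|], so longer walks are covered
too. *)
Lemma dist_leq n x y : has_walk n x y -> dist x y <= n.
Proof.
move=> w; rewrite leqNgt; apply/negP => lt_n.
have lt_nG : n < #|G|.
  by rewrite (leq_trans lt_n) // -[leqRHS](size_iota 0) find_size.
by have := before_find 0 lt_n; rewrite nth_iota // add0n w.
Qed.

Lemma dist_walk x y : has_walk (dist x y) x y.
Proof.
have [_ /(_ x y)/connectP[p pp lp]] := connG.
move: lp; case: (shortenP pp) => q pq uq _ lq.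
have w : has_walk (size q) x y by apply/has_walkP; exists q.
have sq : size q < #|G| by rewrite -[_.+1]/(size (x :: q)) -(card_uniqP uq) max_card.
have hh : has (fun n => has_walk n x y) (iota 0 #|G|).
  by apply/hasP; exists (size q) => //; rewrite mem_iota.
have := nth_find 0 hh; rewrite nth_iota ?add0n //.
by rewrite -[ltnRHS](size_iota 0) -has_find.
Qed.

Lemma dist_eq0 x y : (dist x y == 0) = (x == y).
Proof.
apply/eqP/eqP => [d0|->].
  by have := dist_walk x y; rewrite d0 => /has_walkP[[]// _ [_ /= ->]].
by apply/eqP; rewrite -leqn0; apply: dist_leq; apply/has_walkP; exists [::].
Qed.

Lemma dist_sym x y : dist x y = dist y x.
Proof.
by apply/eqP; rewrite eqn_leq !dist_leq //; apply/has_walk_sym/dist_walk.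
Qed.

Lemma dist_triangle x y z : dist x z <= dist x y + dist y z.
Proof. exact: dist_leq (has_walk_cat (dist_walk x y) (dist_walk y z)). Qed.

Lemma dist_adj x y z : adj y z -> dist x z <= (dist x y).+1.
Proof.
move=> yz; rewrite -addn1; apply: dist_leq.
by apply: has_walk_cat (dist_walk x y) _; rewrite has_walk1.
Qed.

Lemma dist1 x y : (dist x y == 1) = adj x y.
Proof.
apply/eqP/idP => [d1|xy]; first by rewrite -has_walk1 -d1 dist_walk.
apply/eqP; rewrite eqn_leq dist_leq ?has_walk1 //= lt0n dist_eq0.
by apply: contraTneq xy => ->; rewrite adj_irrefl.
Qed.

Lemma dist_pred i x y : dist x y = i.+1 -> exists2 z, adj z y & dist x z = i.
Proof.
move=> dxy; have := dist_walk x y; rewrite dxy => /has_walkSr[z /dist_leq zi zy].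
exists z => //; apply/eqP; rewrite eqn_leq zi -ltnS -dxy.
exact: dist_adj.
Qed.

Lemma dist_between i j x z :
  dist x z = i + j -> exists2 y, dist x y = i & dist y z = j.
Proof.
elim: j z => [|j IHj] z.
  by rewrite addn0; exists z => //; apply/eqP; rewrite dist_eq0.
rewrite addnS => dxz; have [w wz /IHj[y dy dw]] := dist_pred dxz.
exists y => //; apply/eqP; rewrite eqn_leq -{1}dw dist_adj //=.
by have := dist_triangle x y z; lia.
Qed.

Lemma dist_le_diameter x y : dist x y <= diameter G.
Proof.
rewrite /diameter; apply: leq_trans (leq_bigmax x).
exact: (leq_bigmax (F := fun y => dist x y)).
Qed.

Lemma dist_attained i :
  i <= diameter G -> exists x : G, exists y : G, dist x y = i.
Proof.
move=> le_iD; have [gt0 _] := connG.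
have [x Dx] := @eq_bigmax G (fun x => \max_y dist x y) gt0.
have [y Dy] := @eq_bigmax G (fun y => dist x y) gt0.
have dD : dist x y = i + (diameter G - i) by rewrite subnKC // /diameter Dx Dy.
by have [z dz _] := dist_between dD; exists x, z.
Qed.

Lemma odd_dist (A : {set G}) (bipA : forall x y, adj x y -> (x \in A) != (y \in A)) x y :
  odd (dist x y) = ((x \in A) != (y \in A)).
Proof.
move Dd: (dist x y) => i; elim: i y Dd => [|i IHi] y.
  by move/eqP; rewrite dist_eq0 => /eqP->; rewrite eqxx.
case/dist_pred => z /bipA zy /IHi /= ->; move: zy.
by case: (x \in A) (y \in A) (z \in A) => [] [] [].
Qed.

End Distance.

(** * The numerical contradiction *)

(** The summands decrease by [r] until they vanish, so the sum is the area under
a staircase lying above the line of slope [- r]; moving from [s] to [s - r]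
turns the claim into the same one for [J - 1]. *)
Lemma sum_arith_trunc r s J : s <= r * J ->
  s * (s + r) <= 2 * r * \sum_(j < J) (s - r * j).
Proof.
elim: J s => [|J IHJ] s; first by rewrite muln0 leqn0 => /eqP->.
move=> le_s; rewrite big_ord_recl /= muln0 subn0.
have [lt_s|ge_s] := ltnP s r; first by nia.
have le_s' : s - r <= r * J by nia.
have := IHJ _ le_s'.
rewrite (eq_bigr (fun i : 'I_J => s - r - r * i)) => [|i _]; last first.
  by rewrite /bump /=; nia.
by move: (\sum_(i < J) _) => X; nia.
Qed.

(** A subtraction-free form of the bound [k * (1 + ... + J)] for the sum of
[K j * (J - j)]. *)
Lemma sum_weighted_gap (K : nat -> nat) k J :
  (forall j, j < J -> k <= K j) ->
  2 * (\sum_(j < J.+1) K j * j) + k * (J * J.+1) <= 2 * J * \sum_(j < J.+1) K j.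
Proof.
elim: J => [|J IHJ] geK; first by rewrite !big_ord_recl !big_ord0 /= !muln0.
have {}IHJ := IHJ (fun j lt => geK j (ltnW lt)).
have ge_sum : k * J.+1 <= \sum_(j < J.+1) K j.
  rewrite mulnC -[X in X * _ <= _]card_ord -sum_nat_const.
  by apply: leq_sum => j _; apply: geK.
rewrite big_ord_recr /= [in X in _ <= X]big_ord_recr /=.
move: (\sum_(j < J.+1) K j * j) (\sum_(j < J.+1) K j) (K J.+1) IHJ ge_sum => X Y Z.
nia.
Qed.

(** Here [K j] stands for the number of vertices at distance [2j + 1] from a
vertex, [Q j] for the number of pairs at that distance in a product of two sets
of sizes [s] and [s'], and [r] for the deficiency.

If [r * J < s], then [Q j <= K j * (r * j)] is used for all [j]: since the early
[K j] are at least [k > 2 * r], the average of [j] with weights [K j] is too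
small, and [(s - r * J) * (s' - r * J) > 0] concludes.

If [s <= r * J], then [Q j <= K j * minn s (r * j)] leaves out at least
[K j * (s - r * j)] from the bound [K j * s], whose sum is
[s * s' + s * (s + r)]; by [sum_arith_trunc] and [2 * r < k], the total left
out exceeds [s * (s + r)]. *)
Lemma short_flow_bound (K Q : nat -> nat) k r s s' J :
  (forall j, j < J -> k <= K j) ->
  \sum_(j < J.+1) K j = s + s' + r ->
  (forall j, j <= J -> Q j <= K j * s) ->
  (forall j, j <= J -> Q j <= K j * (r * j)) ->
  2 * r < k -> 0 < s -> s <= s' ->
  \sum_(j < J.+1) Q j < s * s'.
Proof.
move=> geK sumK Qs Qr ltk s0 le_s.
have [leJ|ltJ] := leqP s (r * J); last first.
  have : \sum_(j < J.+1) Q j <= r * \sum_(j < J.+1) K j * j.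
    rewrite big_distrr /=; apply: leq_sum => j _.
    by rewrite mulnCA; apply: Qr; rewrite -ltnS.
  have := sum_weighted_gap geK; rewrite sumK.
  move: (\sum_(j < _) Q j) (\sum_(j < _) _) => X Y gap leX.
  have h1 : 2 * X <= 2 * r * Y by nia.
  have h2 : r * (2 * Y + k * (J * J.+1)) <= r * (2 * J * (s + s' + r)).
    by rewrite leq_mul2l gap orbT.
  have h3 : r * (2 * r) * (J * J.+1) <= r * k * (J * J.+1).
    by rewrite leq_mul2r leq_mul2l (ltnW ltk) !orbT.
  have h4 : 0 < (s - r * J) * (s' - r * J) by rewrite muln_gt0; lia.
  nia.
have sumQ : \sum_(j < J.+1) Q j + \sum_(j < J.+1) K j * (s - r * j) <= (s + s' + r) * s.
  rewrite -sumK -big_split big_distrl /=; apply: leq_sum => j _.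
  have le_j : j <= J by rewrite -ltnS.
  have := Qs j le_j; have := Qr j le_j; nia.
have sumJ : k * \sum_(j < J) (s - r * j) <= \sum_(j < J.+1) K j * (s - r * j).
  rewrite big_ord_recr /= big_distrr /= -[leqLHS]addn0 leq_add //.
  by apply: leq_sum => j _; rewrite leq_mul2r geK ?orbT.
have := sum_arith_trunc leJ.
move: (\sum_(j < J.+1) Q j) (\sum_(j < J) _) (\sum_(j < J.+1) _) sumQ sumJ => X Y Z *.
nia.
Qed.

(** * Counting in distance-regular graphs *)

Lemma double_count (T1 T2 : finType) (R : T1 -> T2 -> bool)
    (A1 : {set T1}) (A2 : {set T2}) :
  \sum_(x in A1) #|[set y in A2 | R x y]| = \sum_(y in A2) #|[set x in A1 | R x y]|.
Proof.
have cardE (T : finType) (A : {set T}) (P : pred T) :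
    #|[set y in A | P y]| = \sum_(y in A) P y.
  rewrite -sum1_card (eq_bigl (fun y => (y \in A) && P y)) => [|y]; last by rewrite inE.
  by rewrite big_mkcondr; apply: eq_bigr => y _; case: (P y).
rewrite (eq_bigr (fun x => \sum_(y in A2) R x y)) => [|x _]; last exact: cardE.
by rewrite exchange_big; apply: eq_bigr => y _; rewrite cardE.
Qed.

Section DistanceRegular.
Variable G : sgraph.
Hypothesis connG : connected_graph G.
Variables (k : nat) (b c : nat -> nat).
Hypothesis valG : has_valency G k.
Hypothesis cP : forall i (x y : G), 1 <= i <= diameter G -> dist x y = i ->
  #|[set z in neighbours y | dist x z == i - 1]| = c i.
Hypothesis bP : forall i (x y : G), i < diameter G -> dist x y = i ->
  #|[set z in neighbours y | dist x z == i + 1]| = b i.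
Implicit Types (x y z : G) (U W S : {set G}).

Let D := diameter G.

Definition sphere x i : {set G} := [set y | dist x y == i].

Lemma sphere0 x : sphere x 0 = [set x].
Proof. by apply/setP=> y; rewrite !inE dist_eq0 // eq_sym. Qed.

Lemma card_closer i x y : i < D -> dist x y = i.+1 ->
  #|[set z | adj y z & dist x z == i]| = c i.+1.
Proof.
move=> ltiD dxy; rewrite -(cP _ dxy) //.
by apply: eq_card => z; rewrite !inE subn1.
Qed.

Lemma card_farther i x y : i < D -> dist x y = i ->
  #|[set z | adj y z & dist x z == i.+1]| = b i.
Proof.
move=> ltiD dxy; rewrite -(bP _ dxy) //.
by apply: eq_card => z; rewrite !inE addn1.
Qed.

Lemma c_gt0 i : i < D -> 0 < c i.+1.
Proof.
move=> ltiD; have [x [y dxy]] := dist_attained connG ltiD.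
rewrite -(card_closer ltiD dxy); apply/card_gt0P.
by have [z zy dz] := dist_pred connG dxy; exists z; rewrite inE adj_sym zy dz eqxx.
Qed.

(** Put [y] on a shortest path from [x] to [z], at distance [i] from [x] and [j]
from [z], where [i + j] is a distance that occurs: a neighbour of [y] closer to
[z] has to be farther from [x]. *)
Lemma c_le_b i j : 0 < j -> i + j <= D -> c j <= b i.
Proof.
case: j => // j _ le_ijD; have [x [z dxz]] := dist_attained connG le_ijD.
have [y dxy dyz] := dist_between connG dxz.
have ltiD : i < D by lia.
have ltjD : j < D by lia.
rewrite -(card_farther ltiD dxy) -(@card_closer j z y) 1?dist_sym //.
apply: subset_leq_card; apply/subsetP=> w; rewrite !inE => /andP[yw /eqP dzw].
rewrite yw eqn_leq -{1}dxy dist_adj //=.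
have := dist_triangle connG x w z; rewrite dxz [dist w z]dist_sym // dzw; lia.
Qed.

Lemma card_nbr x : #|[set y | adj x y]| = k.
Proof. exact: valG. Qed.

Lemma b0 : 0 < D -> b 0 = k.
Proof.
move=> D0; have [x [y dxy]] := dist_attained connG (leq0n D).
have dxx : dist x x = 0 by apply/eqP; rewrite dist_eq0.
rewrite -(card_farther D0 dxx) -(card_nbr x); apply: eq_card => z.
by rewrite !inE dist1 // andbb.
Qed.

(** Both sides count the edges between two consecutive spheres around [x]. *)
Lemma sphere_step x i : i < D ->
  c i.+1 * #|sphere x i.+1| = b i * #|sphere x i|.
Proof.
move=> ltiD; have := double_count (@adj G) (sphere x i.+1) (sphere x i).
rewrite (eq_bigr (fun=> c i.+1)) => [|y]; last first.
  rewrite inE => /eqP dxy; rewrite -(card_closer ltiD dxy).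
  by apply: eq_card => z; rewrite !inE andbC.
rewrite [RHS](eq_bigr (fun=> b i)) => [|y]; last first.
  rewrite inE => /eqP dxy; rewrite -(card_farther ltiD dxy).
  by apply: eq_card => z; rewrite !inE andbC adj_sym.
by rewrite !sum_nat_const mulnC => ->; rewrite mulnC.
Qed.

(** The vertices counted are those to which the edge [zw] starts a shortest path
of length [i + 1] from [z].  That their number depends on [i] only is what
spreads shortest paths evenly over the edges.  The recursion on [i] is a double
count of the edges between two consecutive such sets: seen from the outer one
they are governed by the distance to [w], from the inner one by the distance to
[z]. *)
Lemma card_edge_sphere w z i : adj w z -> i < D ->
  k * #|[set x | (dist w x == i) && (dist z x == i.+1)]| = b i * #|sphere w i|.
Proof.
move=> wz; elim: i => [|i IHi] ltiD.
  rewrite b0 // sphere0 cards1; congr (_ * _); rewrite -[RHS](cards1 w); apply: eq_card => x.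
  rewrite !inE dist_eq0 // eq_sym; case: eqVneq => //= ->.
  by rewrite dist1 // adj_sym.
set N := fun j => [set x | (dist w x == j) && (dist z x == j.+1)].
have recN : c i.+1 * #|N i.+1| = b i.+1 * #|N i|.
  have := double_count (@adj G) (N i.+1) (N i).
  rewrite (eq_bigr (fun=> c i.+1)) => [|x]; last first.
    rewrite inE => /andP[/eqP dwx /eqP dzx].
    rewrite -(card_closer (ltnW ltiD) dwx); apply: eq_card => y; rewrite !inE.
    rewrite andbC; case xy: (adj x y) => //=; case: eqP => //= dwy.
    have := dist_adj connG z xy; have := dist_adj connG w wz.
    rewrite eqn_leq; have := dist_triangle connG z w y.
    have -> : dist z w = 1 by apply/eqP; rewrite dist1 // adj_sym.
    rewrite dwy; rewrite adj_sym in xy; have := dist_adj connG z xy; lia.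
  rewrite [RHS](eq_bigr (fun=> b i.+1)) => [|x]; last first.
    rewrite inE => /andP[/eqP dwx /eqP dzx].
    rewrite -(card_farther ltiD dzx); apply: eq_card => y; rewrite !inE.
    rewrite andbC adj_sym; case xy: (adj x y) => //=.
    case: (dist z y =P i.+2) => dzy; rewrite ?andbF // andbT.
    apply/eqP.
    have := dist_adj connG w xy; have := dist_triangle connG z w y.
    have -> : dist z w = 1 by apply/eqP; rewrite dist1 // adj_sym.
    by move: (dist w x) (dist w y) dwx dzy; lia.
  by rewrite !sum_nat_const mulnC => ->; rewrite mulnC.
have c0 := c_gt0 (ltnW ltiD).
apply/eqP; rewrite -(eqn_pmul2l c0) -/(N i.+1); apply/eqP.
by rewrite mulnCA recN mulnCA IHi 1?ltnW // -sphere_step 1?ltnW // mulnCA.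
Qed.

(* [x0] is only a reference point: spheres of radius at most [D] have a size
   that does not depend on the centre, by [card_sphere]. *)
Variable x0 : G.
Definition sphere_card i := #|sphere x0 i|.

Lemma card_sphere x i : i <= D -> #|sphere x i| = sphere_card i.
Proof.
elim: i => [|i IHi] ltiD; first by rewrite /sphere_card !sphere0 !cards1.
have c0 := c_gt0 ltiD.
by apply/eqP; rewrite -(eqn_pmul2l c0) !sphere_step // IHi // ltnW.
Qed.

Lemma sphere_card_step i : i < D -> c i.+1 * sphere_card i.+1 = b i * sphere_card i.
Proof. exact: sphere_step. Qed.

Lemma sphere_card1 : sphere_card 1 = k.
Proof. by rewrite -(card_nbr x0); apply: eq_card => z; rewrite !inE dist1. Qed.

(** The recursion for [sphere_card] relates [i] to [i + 1] and [j - 1] to [j];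
as [c j <= b i] and [c i.+1 <= b j.-1] by [c_le_b], the inequality for the
inner pair [i + 1], [j - 1] gives the one for [i], [j]. *)
Lemma sphere_card_le i j : i <= j -> i + j <= D -> sphere_card i <= sphere_card j.
Proof.
move=> le_ij; rewrite -(subnKC le_ij); move: (j - i) => n {j le_ij}.
have [m] := ubnP n; elim: m i n => // m IHm i [|n] ltnm leD; first by rewrite addn0.
have ltiD : i < D by lia.
have ltjD : i + n < D by lia.
have le_mid : sphere_card i.+1 * c i.+1 <= sphere_card (i + n) * b (i + n).
  case: n ltnm leD ltjD => [|n] ltnm leD ltjD.
    by rewrite addn0 mulnC sphere_card_step // mulnC.
  rewrite leq_mul //; last by apply: c_le_b; lia.
  by have := IHm i.+1 n; rewrite addnS addSn => -> //; lia.
have cb : c (i + n).+1 <= b i by apply: c_le_b; lia.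
rewrite addnS -(leq_pmul2l (c_gt0 ltjD)) sphere_card_step //.
apply: leq_trans (leq_mul cb (leqnn _)) _.
by rewrite -sphere_card_step // mulnC [leqRHS]mulnC.
Qed.

(** Ordered pairs, so an edge inside [U :&: W] appears twice. *)
Definition edge_pairs U W := [set p : G * G | [&& p.1 \in U, p.2 \in W & adj p.1 p.2]].

Lemma card_edge_pairs U W : #|edge_pairs U W| = \sum_(y in U) #|[set z in W | adj y z]|.
Proof.
rewrite -sum1_card (eq_bigl (fun p => (p.1 \in U) && (p.2 \in [set z in W | adj p.1 z]))).
  rewrite -(pair_big_dep (mem U) (fun y z => z \in [set z in W | adj y z]) (fun _ _ => 1)) /=.
  by apply: eq_bigr => y _; rewrite sum1_card.
by move=> p; rewrite !inE.
Qed.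

Definition pairs_at S U i := \sum_(x in S) #|U :&: sphere x i|.

(** The last step of a shortest path from [x] into [U] comes from [W] or
crosses from outside [W]. *)
Lemma restricted_sphere_step x U W i : i < D ->
  c i.+1 * #|U :&: sphere x i.+1| <= b i * #|W :&: sphere x i| +
    #|[set p in edge_pairs U (~: W) | (dist x p.1 == i.+1) && (dist x p.2 == i)]|.
Proof.
move=> ltiD.
have -> : [set p in edge_pairs U (~: W) | (dist x p.1 == i.+1) && (dist x p.2 == i)]
    = edge_pairs (U :&: sphere x i.+1) (~: W :&: sphere x i).
  apply/setP=> p; rewrite !inE.
  by case: (p.1 \in U) (p.2 \in W) (adj _ _) (_ == _) (_ == _) => [] [] [] [] [].
have -> : c i.+1 * #|U :&: sphere x i.+1| =
    #|edge_pairs (U :&: sphere x i.+1) (W :&: sphere x i)| +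
    #|edge_pairs (U :&: sphere x i.+1) (~: W :&: sphere x i)|.
  rewrite !card_edge_pairs -big_split /= mulnC -sum_nat_const; apply: eq_bigr => y.
  rewrite !inE => /andP[_ /eqP dxy]; rewrite -(card_closer ltiD dxy).
  rewrite -(cardsID W); congr (_ + _); apply: eq_card => z; rewrite !inE;
    by case: (z \in W) (adj _ _) (_ == _) => [] [] [].
rewrite leq_add2r card_edge_pairs double_count mulnC -sum_nat_const.
apply: leq_sum => z; rewrite !inE => /andP[_ /eqP dxz].
rewrite -(card_farther ltiD dxz); apply: subset_leq_card; apply/subsetP=> y.
by rewrite !inE adj_sym => /andP[/andP[_ ->] ->].
Qed.

(** Sum of [restricted_sphere_step] over [S].  An edge crossing from outside [W]
into [U] is the last step for as many starting points as [card_edge_sphere]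
allows, hence for at most [sphere_card i * b i / k] points of [S]. *)
Lemma pairs_at_step S U W i m m' : i < D ->
  pairs_at S W i <= sphere_card i * m -> #|edge_pairs U (~: W)| <= k * m' ->
  pairs_at S U i.+1 <= sphere_card i.+1 * (m + m').
Proof.
move=> ltiD leW cut.
rewrite -(leq_pmul2l (c_gt0 ltiD)) mulnA sphere_card_step //.
have le1 : c i.+1 * pairs_at S U i.+1 <= b i * pairs_at S W i +
   \sum_(x in S) #|[set p in edge_pairs U (~: W) | (dist x p.1 == i.+1) && (dist x p.2 == i)]|.
  rewrite !big_distrr -big_split /=; apply: leq_sum => x _.
  exact: restricted_sphere_step.
apply: leq_trans le1 _; rewrite mulnDr leq_add //.
  by rewrite -mulnA leq_mul2l leW orbT.
rewrite double_count.
have [k0|k0] := posnP k.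
  by move: cut; rewrite k0 mul0n leqn0 cards_eq0 => /eqP->; rewrite big_set0.
rewrite -(leq_pmul2l k0) big_distrr /=.
apply: leq_trans (_ : \sum_(p in edge_pairs U (~: W)) b i * sphere_card i <= _).
  apply: leq_sum => -[y z]; rewrite inE /= => /and3P[_ _ yz].
  rewrite -(card_sphere z (ltnW ltiD)) -(@card_edge_sphere z y) 1?adj_sym //.
  apply: leq_mul => //.
  apply: subset_leq_card; apply/subsetP=> x.
  by rewrite !inE ![dist x _]dist_sym // => /and3P[_ -> ->].
by rewrite sum_nat_const mulnC [leqRHS]mulnCA leq_mul2l cut orbT.
Qed.

Lemma pairs_at_le_l S U i : i <= D -> pairs_at S U i <= sphere_card i * #|S|.
Proof.
move=> leiD; rewrite mulnC -sum_nat_const; apply: leq_sum => x _.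
by rewrite -(card_sphere x leiD) subset_leq_card // subsetIr.
Qed.

Lemma pairs_at_le_r S U i : i <= D -> pairs_at S U i <= sphere_card i * #|U|.
Proof.
move=> leiD; rewrite /pairs_at.
rewrite (eq_bigr (fun x => #|[set y in U | dist x y == i]|)) => [|x _]; last first.
  by apply: eq_card => y; rewrite !inE.
rewrite double_count mulnC -sum_nat_const; apply: leq_sum => x _.
rewrite -(card_sphere x leiD) subset_leq_card //; apply/subsetP=> y.
by rewrite !inE dist_sym // => /andP[].
Qed.

Lemma card_edge_pairs_sym U W : #|edge_pairs U W| = #|edge_pairs W U|.
Proof.
rewrite !card_edge_pairs double_count; apply: eq_bigr => z _.
by apply: eq_card => y; rewrite !inE adj_sym.
Qed.

Lemma card_edge_pairsC U W : #|edge_pairs U W| + #|edge_pairs U (~: W)| = k * #|U|.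
Proof.
rewrite !card_edge_pairs -big_split mulnC -sum_nat_const /=; apply: eq_bigr => y _.
rewrite -(card_nbr y) -[RHS](cardsID W); congr (_ + _); apply: eq_card => z;
  by rewrite !inE andbC.
Qed.

Lemma edge_pairs0 U W :
  (forall y z, y \in U -> adj y z -> z \notin W) -> #|edge_pairs U W| = 0.
Proof.
move=> noE; apply/eqP; rewrite cards_eq0; apply/set0Pn => -[p].
by rewrite inE => /and3P[pU pW /(noE _ _ pU)]; rewrite pW.
Qed.

Variable A : {set G}.
Hypothesis bipA : forall x y, adj x y -> (x \in A) != (y \in A).
Hypothesis k_gt0 : 0 < k.

(** The [k * #|S|] edges at [S] all end in its neighbourhood, each point of which
receives at most [k]. *)
Lemma card_le_image_of S : #|S| <= #|image_of (@adj G) S|.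
Proof.
set N := image_of _ _.
rewrite -(leq_pmul2l k_gt0) -(card_edge_pairsC S N) -(card_edge_pairsC N S).
rewrite (card_edge_pairs_sym S) [X in _ + X <= _]edge_pairs0 ?addn0 ?leq_addr //.
by move=> y z yS yz; rewrite inE negbK; apply/image_ofP; exists y.
Qed.

Lemma card_bipartition : #|~: A| = #|A|.
Proof.
apply/eqP; rewrite -(eqn_pmul2l k_gt0) -(card_edge_pairsC A (~: A)).
rewrite -(card_edge_pairsC (~: A) A).
rewrite (card_edge_pairs_sym (~: A)) setCK [X in _ == _ + X]edge_pairs0.
  by rewrite addn0 -[X in _ == X]addn0 eqn_add2l edge_pairs0 // => y z;
    rewrite !inE => yA /bipA; rewrite (negPf yA); case: (z \in A).
by move=> y z yA /bipA; rewrite yA; case: (z \in A).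
Qed.

Lemma diameter_gt0 : 0 < D.
Proof.
have [y] : exists y, y \in [set y | adj x0 y] by apply/card_gt0P; rewrite card_nbr.
by rewrite inE -dist1 // => /eqP <-; apply: dist_le_diameter.
Qed.

(** The bound on [j] comes from the largest odd number up to [D]: [j.*2.+1 <= D]
amounts to [j <= (D.-1)./2]. *)
Lemma sum_odd_spheres x U : x \in A -> U \subset ~: A ->
  \sum_(j < (D.-1)./2.+1) #|U :&: sphere x j.*2.+1| = #|U|.
Proof.
move=> xA /subsetP UA; pose R (j : 'I_(D.-1)./2.+1) y := dist x y == j.*2.+1.
have -> : \sum_(j < (D.-1)./2.+1) #|U :&: sphere x j.*2.+1| =
    \sum_(j in [set: 'I_(D.-1)./2.+1]) #|[set y in U | R j y]|.
  apply: eq_big => j; first by rewrite inE.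
  by move=> _; apply: eq_card => y; rewrite !inE.
rewrite double_count -[RHS]sum1_card; apply: eq_bigr => y /UA.
rewrite inE => yA; have /esym := odd_dist connG bipA x y.
rewrite xA (negPf yA) /= => /esym odd_xy.
have leD := dist_le_diameter x y.
have lt_half : (dist x y)./2 < (D.-1)./2.+1.
  by rewrite -/D in leD; move: (dist x y) odd_xy leD; lia.
rewrite -(cards1 (Ordinal lt_half)); apply: eq_card => j; rewrite !inE /R /=.
rewrite -(inj_eq val_inj) /=; apply/eqP/eqP; move: (dist x y) odd_xy; lia.
Qed.

(** Two steps at a time, from [T] to [A :\: S] and back to [T].  A neighbour of
[T] is always in [A :\: S], so the step into [T] adds nothing; a neighbour of
[A :\: S] outside [T] is in [N], and the [k * (#|N| - #|S|)] edges of this kind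
add one deficiency. *)
Lemma pairs_at_odd_bound S (N := image_of (@adj G) S) (T := ~: A :\: N) j :
  S \subset A -> j.*2 < D ->
  pairs_at S T j.*2.+1 <= sphere_card j.*2.+1 * ((#|N| - #|S|) * j).
Proof.
move=> SA; set r := #|N| - #|S|.
have cutT : #|edge_pairs T (~: (A :\: S))| <= k * 0.
  rewrite edge_pairs0 // => y z; rewrite in_setD in_setC => /andP[yN yA] yz.
  rewrite in_setC negbK in_setD andbC.
  have -> /= : z \in A by have := bipA yz; rewrite (negPf yA); case: (z \in A).
  apply: contra yN => zS; apply/image_ofP; by exists z; rewrite // adj_sym.
have cutA : #|edge_pairs (A :\: S) (~: T)| <= k * r.
  apply: (@leq_trans #|edge_pairs (~: S) N|).
    apply: subset_leq_card; apply/subsetP=> -[y z]; rewrite !in_set /=.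
    case/and3P => /andP[-> yA] zT yz; rewrite yz andbT /=.
    move: zT; rewrite negb_and negbK => /orP[] // zA.
    by have := bipA yz; rewrite yA -[z \in A]negbK zA.
  rewrite card_edge_pairs_sym /r mulnBr -(card_edge_pairsC N S) -(card_edge_pairsC S N).
  rewrite (card_edge_pairs_sym S) [X in _ - (_ + X)]edge_pairs0 ?addn0 ?addKn //.
  by move=> y z yS yz; rewrite inE negbK; apply/image_ofP; exists y.
elim: j => [|j IHj] ltD.
  rewrite muln0; apply: (pairs_at_step (W := A :\: S) (m := 0) _ _ cutT) => //.
  rewrite muln0 leqn0 /pairs_at sum_nat_eq0; apply/forall_inP => x xS.
  rewrite cards_eq0; apply/set0Pn => -[y]; rewrite !inE dist_eq0 //.
  by case/andP=> /andP[yS _] /eqP xy; rewrite -xy xS in yS.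
rewrite mulnS -[_ + r * j]addn0; apply: (pairs_at_step (W := A :\: S) _ _ cutT) => //.
rewrite doubleS addnC; apply: (pairs_at_step (W := T) _ _ cutA); first by lia.
by apply: IHj; lia.
Qed.

(** If it failed, [S] and the vertices of [~: A] not adjacent to it would
contradict [short_flow_bound], which is applied with the smaller of the two
sets first. *)
Lemma expansion S t : S \subset A -> S != set0 -> #|S| + t <= #|A| -> t.*2 <= k.+1 ->
  #|S| + t <= #|image_of (@adj G) S|.
Proof.
move=> SA S0 le_n le_t; rewrite leqNgt; apply/negP => ltN.
have leSN := card_le_image_of S.
have NA : image_of (@adj G) S \subset ~: A.
  apply/subsetP=> y /image_ofP[x xS xy]; rewrite inE.
  by have := bipA xy; rewrite (subsetP SA x xS); case: (y \in A).
have Dgt0 := diameter_gt0.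
pose J := (D.-1)./2; pose T := ~: A :\: image_of (@adj G) S.
have ltJD j : j <= J -> j.*2 < D by rewrite /J; lia.
have cardT : #|T| + #|image_of (@adj G) S| = #|A|.
  by rewrite -card_bipartition addnC -(cardsID (image_of (@adj G) S) (~: A)) (setIidPr NA).
have [x1 x1S] := set0Pn _ S0.
have sumK : \sum_(j < J.+1) sphere_card j.*2.+1 = #|A|.
  rewrite -card_bipartition -(sum_odd_spheres (subsetP SA _ x1S) (subxx _)).
  apply: eq_bigr => j _; rewrite -(card_sphere x1); last by apply: ltJD; rewrite -ltnS.
  apply: eq_card => y; rewrite !inE; case: eqP => dxy; rewrite ?andbF // andbT.
  have := odd_dist connG bipA x1 y; rewrite dxy (subsetP SA _ x1S) /= odd_double.
  by case: (y \in A).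
have sumQ : \sum_(j < J.+1) pairs_at S T j.*2.+1 = #|S| * #|T|.
  rewrite exchange_big -sum_nat_const; apply: eq_bigr => x xS.
  by apply: sum_odd_spheres; rewrite ?(subsetP SA) // subsetDl.
have geK j : j < J -> k <= sphere_card j.*2.+1.
  rewrite /J => ltj; rewrite -sphere_card1.
  by apply: sphere_card_le => //; lia.
have Qr j : j <= J -> pairs_at S T j.*2.+1 <=
    sphere_card j.*2.+1 * ((#|image_of (@adj G) S| - #|S|) * j).
  by move=> /ltJD; apply: pairs_at_odd_bound.
have s0 : 0 < #|S| by rewrite card_gt0.
have lt_rk : 2 * (#|image_of (@adj G) S| - #|S|) < k by lia.
have [leST|/ltnW leTS] := leqP #|S| #|T|.
  have Qs j (lej : j <= J) := pairs_at_le_l S T (ltJD _ lej).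
  have := short_flow_bound geK _ Qs Qr lt_rk s0 leST.
  by rewrite sumQ ltnn sumK => H; suff: false by []; apply: H; lia.
have t0 : 0 < #|T| by lia.
have Qs j (lej : j <= J) := pairs_at_le_r S T (ltJD _ lej).
have := short_flow_bound geK _ Qs Qr lt_rk t0 leTS.
by rewrite sumQ [_ * #|S|]mulnC ltnn sumK => H; suff: false by []; apply: H; lia.
Qed.

End DistanceRegular.

(** * Matchings *)
Section Matchings.
Variables (G : sgraph) (A : {set G}).
Hypothesis bipA : forall x y : G, adj x y -> (x \in A) != (y \in A).
Implicit Types (M N : {set {set G}}) (x y z : G).

Lemma edgeP E : E \in edges G -> exists x, exists2 y, adj x y & E = [set x; y].
Proof. by case/imsetP=> -[x y]; rewrite inE /= => xy ->; exists x, y. Qed.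

(** Every edge of the matching has exactly one end in [A]. *)
Lemma card_matched_side M : matching M -> #|A :&: cover M| = #|M|.
Proof.
case=> /subsetP sME tM.
have -> : #|A :&: cover M| = \sum_(x in cover M) (x \in A).
  rewrite -sum1_card [LHS]big_mkcond [RHS]big_mkcond /=; apply: eq_bigr => x _.
  by rewrite inE; case: (x \in A); case: (x \in cover M).
rewrite big_trivIset //= -sum1_card; apply: eq_bigr => E /sME /edgeP[x [y xy ->]].
have neq_xy : x \notin [set y].
  by rewrite inE; apply: contraTneq xy => ->; rewrite adj_irrefl.
rewrite big_setU1 //= big_set1; have := bipA xy.
by case: (x \in A); case: (y \in A).
Qed.

End Matchings.

(** Hall's theorem matches the uncovered part of [A] into the uncovered part of
[~: A].  These parts have the same size, because [M] covers equally many
vertices of both classes, so the new edges cover everything. *)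
Lemma matching_extends (G : sgraph) (A : {set G}) (M : {set {set G}}) :
    (forall x y : G, adj x y -> (x \in A) != (y \in A)) ->
    #|~: A| = #|A| -> matching M ->
    (forall S : {set G}, S \subset A :\: cover M ->
       #|S| <= #|image_of (@adj G) S :\: cover M|) ->
  exists2 N, perfect_matching N & M \subset N.
Proof.
move=> bipA cardA matM hallM; have [sME tM] := matM.
pose e (x y : G) := adj x y && (y \notin cover M).
have [f [fA fI]] : exists f : G -> option G,
    {in A :\: cover M, forall x, exists2 u, f x = Some u & e x u} /\
    {in A :\: cover M &, injective f}.
  apply: hall_marriage => S /hallM /leq_trans-> //; apply: subset_leq_card.
  apply/subsetP=> y /setDP[/image_ofP[x xS xy] yM].
  by apply/image_ofP; exists x; rewrite // /e xy.
pose g x := odflt x (f x).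
have gE x : x \in A :\: cover M -> [/\ adj x (g x), g x \notin cover M & g x \notin A].
  move=> xA; have [u fx /andP[xu uM]] := fA x xA; rewrite /g fx; split=> //=.
  by have := bipA _ _ xu; case/setDP: xA => -> _; case: (u \in A).
have gI : {in A :\: cover M &, injective g}.
  move=> x y xA yA; have [u fx _] := fA x xA; have [v fy _] := fA y yA.
  by rewrite /g fx fy /= => uv; apply: fI; rewrite // fx fy uv.
pose N := M :|: [set [set x; g x] | x in A :\: cover M].
have gN x : x \in A :\: cover M -> [set x; g x] \in N.
  by move=> xA; rewrite inE; apply/orP; right; apply: imset_f.
have g_onto : g @: (A :\: cover M) = ~: A :\: cover M.
  apply/eqP; rewrite eqEcard; apply/andP; split.
    by apply/subsetP=> _ /imsetP[x xA ->]; have [_ gM gA] := gE x xA; rewrite !in_set gM.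
  rewrite card_in_imset // !cardsD cardA (card_matched_side bipA matM).
  rewrite (@card_matched_side _ (~: A)) // => x y /bipA.
  by rewrite !inE; case: (x \in A); case: (y \in A).
exists N; last exact: subsetUl.
split; first split.
- rewrite subUset sME; apply/subsetP=> _ /imsetP[x xA ->].
  have [xg _ _] := gE x xA.
  by apply/imsetP; exists (x, g x); rewrite ?inE.
- have sep E F z : E \in N -> F \in N -> z \in E -> z \in F -> E = F.
    have new_uncovered x : x \in A :\: cover M -> z \in [set x; g x] -> z \notin cover M.
      move=> xA /set2P[->|->]; first by case/setDP: xA.
      by case: (gE x xA).
    have old_covered E' : E' \in M -> z \in E' -> z \in cover M.
      by move=> EM zE; apply/bigcupP; exists E'.
    case/setUP=> [EM|/imsetP[x xA ->]] /setUP[FM|/imsetP[y yA ->]] zE zF.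
    + apply: contraTeq zE => /(trivIsetP tM E F EM FM) disEF.
      by rewrite (disjointFl disEF zF).
    + by have := new_uncovered y yA zF; rewrite (old_covered E).
    + by have := new_uncovered x xA zE; rewrite (old_covered F).
    have [_ _ gxA] := gE x xA; have [_ _ gyA] := gE y yA.
    have [xA' _] := setDP xA; have [yA' _] := setDP yA.
    suff -> : x = y by [].
    case/set2P: zE zF => -> /set2P[] // h; last exact: gI.
      by rewrite -h xA' in gyA.
    by rewrite h yA' in gxA.
  apply/trivIsetP=> E F EN FN neqEF; rewrite -setI_eq0; apply/set0Pn => -[z].
  by case/setIP=> zE zF; rewrite (sep E F z) ?eqxx in neqEF.
move=> x; have [/bigcupP[E EM xE]|xM] := boolP (x \in cover M).
  by exists E; rewrite // inE EM.
have [xA|xA] := boolP (x \in A).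
  by exists [set x; g x]; [apply: gN; rewrite inE xM | rewrite set21].
have : x \in g @: (A :\: cover M) by rewrite g_onto !in_set xM.
by case/imsetP=> y yA ->; exists [set y; g y]; [apply: gN | rewrite set22].
Qed.

Theorem theorem3p17 (G : sgraph) (k : nat)
    (hbip : bipartite G) (hdr : distance_regular G)
    (hval : has_valency G k) (hk : 2 <= k) :
  extendable G ((k + 1) %/ 2).
Proof.
have [A bipA] := hbip; have [connG [b [c [cP bP]]]] := hdr.
have [G0 _] := connG; have [x0 _] := card_gt0P G0.
have k0 : 0 < k by apply: ltnW.
have cardA := card_bipartition hval bipA k0.
have cardG : #|G| = #|A|.*2 by rewrite -(cardsC A) cardA addnn.
have le_kA : k <= #|A|.
  have sub_side (B : {set G}) : neighbours x0 \subset B -> k <= #|B|.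
    by move=> sB; rewrite -(hval x0); apply: subset_leq_card.
  have [xA|xA] := boolP (x0 \in A).
    rewrite -cardA; apply: sub_side; apply/subsetP=> y; rewrite !inE => /bipA.
    by rewrite xA; case: (y \in A).
  apply: sub_side; apply/subsetP=> y; rewrite inE => /bipA.
  by rewrite (negPf xA); case: (y \in A).
have expA S := expansion connG hval cP bP x0 bipA k0 (S := S).
split=> //.
- by rewrite cardG odd_double.
- have mat0 : matching (set0 : {set {set G}}).
    by split; [apply: sub0set | apply/trivIsetP=> E F; rewrite inE].
  have [|N] := matching_extends bipA cardA mat0; last by exists N.
  move=> S _; rewrite /cover big_set0 setD0.
  exact: card_le_image_of hval k0 S.
- by rewrite cardG doubleK; lia.
move=> M matM cardM; apply: (matching_extends bipA cardA matM) => S.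
rewrite subsetD => /andP[SA SM].
have [->|S0] := eqVneq S set0; first by rewrite cards0.
have bipC x y : adj x y -> (x \in ~: A) != (y \in ~: A).
  by move/bipA; rewrite !inE; case: (x \in A); case: (y \in A).
have le_n : #|S| + (k + 1) %/ 2 <= #|A|.
  rewrite -cardM -(card_matched_side bipA matM) -(cardsID (cover M) A) addnC leq_add2l.
  by apply: subset_leq_card; rewrite subsetD SA.
have le_t : ((k + 1) %/ 2).*2 <= k.+1 by lia.
have := expA S _ SA S0 le_n le_t; rewrite -(cardsID (cover M) (image_of _ _)).
have NA : image_of (@adj G) S \subset ~: A.
  apply/subsetP=> y /image_ofP[x xS /bipA]; rewrite in_setC (subsetP SA x xS).
  by case: (y \in A).
have : #|image_of (@adj G) S :&: cover M| <= (k + 1) %/ 2.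
  by rewrite -cardM -(card_matched_side bipC matM) subset_leq_card // setSI.
move=> le_cap le_expand; rewrite -(leq_add2l ((k + 1) %/ 2)) addnC.
by apply: leq_trans le_expand _; rewrite leq_add2r.
Qed.
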